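(* Let $\mu$ be a Borel probability measure on the unit circle $\mathbb{T}$, identified with $[0,1)$, such that $\sum_{n=1}^\infty |\hat{\mu}(n)|<\frac{1}{2}$. Then for every $x\in (0,1)$ the local dimension of $\mu$ at $x$ exists and $\dim_{\rm loc}(\mu,x)=1$.
   Context: The unit circle $\mathbb{T}$ is identified with $[0,1)$, and $e(x)=\exp(2\pi i x)$. The Fourier coefficients of a finite Borel measure $\mu$ on $\mathbb{T}$ are $\hat{\mu}(n)=\int_{\mathbb{T}} e(-nx)\,d\mu(x)$, $n\in\mathbb{Z}$. The lower and upper local dimensions of a measure $\mu$ on $\mathbb{T}$ at a point $x$ are $$\underline{\dim}(\mu,x)=\liminf_{r\to 0+}\frac{\log \mu(B_r(x))}{\log r},\qquad \overline{\dim}(\mu,x)=\limsup_{r\to 0+}\frac{\log \mu(B_r(x))}{\log r},$$ where $B_r(x)$ is the open ball centered at $x$ with radius $r$ (for $x\in(0,1)$ and small $r$, this is the arc $(x-r,x+r)$). If the two coincide, the local dimension of $\mu$ at $x$ is said to exist, and the common value is denoted $\dim_{\rm loc}(\mu,x)$. *)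

(* Defs.v *)
From HB Require Import structures.
From mathcomp Require Import all_boot all_order all_algebra.
From mathcomp Require Import all_classical all_reals all_analysis.
From mathcomp Require Export complex.
Set Implicit Arguments.
Unset Strict Implicit.
Unset Printing Implicit Defensive.
Import Order.TTheory GRing.Theory Num.Theory.
Import numFieldNormedType.Exports.
Local Open Scope classical_set_scope.
Local Open Scope ring_scope.
Local Open Scope complex_scope.

Section circle.
Context {R : realType}.
Implicit Types (x y r : R) (A : set R) (n : int).

(* The unit circle, as the fundamental domain [0, 1). Its Borel sets are the
   Borel subsets of R contained in it, so a Borel measure on the circle is a
   Borel measure on R carried by [unit_circle]. *)
Definition unit_circle : set R := `[0, 1[.

(* Arc-length distance between two points of [0, 1), with 0 and 1 glued. *)
Definition circle_dist x y : R := Num.min `|x - y| (1 - `|x - y|).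

Definition circle_ball x r : set R :=
  unit_circle `&` [set y | circle_dist x y < r].

(* exp(2 pi i x), by Euler's formula *)
Definition e x : R[i] := cos (2 * pi * x) +i* sin (2 * pi * x).

Implicit Type mu : {measure set (measurableTypeR R) -> \bar R}.

Definition complex_integral mu A (f : R -> R[i]) : R[i] :=
  (\int[mu]_(x in A) complex.Re (f x)) +i* (\int[mu]_(x in A) complex.Im (f x)).

Definition fourier_coef mu n : R[i] :=
  complex_integral mu unit_circle (fun x => e (- n%:~R * x)).

(* [lne 0 = -oo], so the quotient is +oo when the ball is null and r < 1. *)
Definition log_ratio mu x r : \bar R :=
  (lne (mu (circle_ball x r)) / (ln r)%:E)%E.

Definition lower_local_dim mu x : \bar R := limf_einf (log_ratio mu x) 0^'+.

Definition upper_local_dim mu x : \bar R := limf_esup (log_ratio mu x) 0^'+.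

Definition local_dim_exists mu x : Prop :=
  lower_local_dim mu x = upper_local_dim mu x.

(* The local dimension, meaningful when [local_dim_exists mu x] holds. *)
Definition local_dim mu x : \bar R := lower_local_dim mu x.

End circle.

(* Main.v *)
Require Import Defs.
From HB Require Import structures.
From mathcomp Require Import all_boot all_order all_algebra.
From mathcomp Require Import zify ring lra.
From mathcomp Require Import all_classical all_reals all_analysis.
From mathcomp Require Import measurable_realfun complex.
Import Order.TTheory GRing.Theory Num.Theory.
Import numFieldNormedType.Exports.
Local Open Scope classical_set_scope.
Local Open Scope ring_scope.

(** Let [S] be the sum of the moduli of the Fourier coefficients of positive
    order, so that [S < 1/2]. The idea is that [mu] is comparable to Lebesgue
    measure at every scale, because it is so when tested against trigonometric
    polynomials whose coefficients are bounded by their mean.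

    The test functions are the kernels [cos (pi (y - x)) ^ 2n], which
    concentrate at [x] at scale [1 / sqrt n]. Their Fourier coefficients are
    the numbers [C(2n, j) / 4^n], up to unimodular factors, and the largest one
    is the mean [a_n = C(2n, n) / 4^n]. Integrating the finite Fourier expansion
    term by term shows that the integral of the kernel against [mu] lies
    between [(1 - 2S) a_n] and [(1 + 2S) a_n] ([cos_kernel_integral]), and [a_n]
    is of order [1 / sqrt n] ([central_coef_le], [central_coef_ge]).

    Choosing [n] of order [1 / r^2] gives two bounds on the mass of the ball of
    radius [r]. The kernel is bounded below on the ball, so the mass is at most
    a multiple of [r] ([ball_mass_le]). Conversely, the kernel of order [2n] is
    the square of the kernel of order [n], which is small off the ball; hence
    the tail of its integral is a small multiple of [a_n], and a fixed part of
    the integral must come from the ball, whose mass is therefore at least a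
    multiple of [r] ([ball_mass_ge]).

    Between [c r] and [C r], the logarithm of the mass is asymptotic to [log r],
    which is the assertion ([log_ratio_near]). *)

(** * Powers of the cosine *)

(** The binomial expansion of [(e^(it) + e^(-it))^m], kept real by the product
    formula [2 cos t cos u = cos (u + t) + cos (u - t)] and Pascal's rule. *)
Lemma cos_expn_sum (R : realType) (t : R) m :
  (2 * cos t) ^+ m =
  \sum_(j < m.+1) 'C(m, j)%:R * cos ((m%:R - 2 * j%:R) * t).
Proof.
elim: m => [|m IHm].
  by rewrite big_ord1 expr0 bin0 mul1r mulr0 subr0 mul0r cos0.
have prod_cos u : 2 * cos t * cos u = cos (u + t) + cos (u - t).
  by rewrite cosD cosB; ring.
have step j : 2 * cos t * ('C(m, j)%:R * cos ((m%:R - 2 * j%:R) * t)) =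
    'C(m, j)%:R * cos ((m.+1%:R - 2 * j%:R) * t) +
    'C(m, j)%:R * cos ((m.+1%:R - 2 * j.+1%:R) * t).
  rewrite mulrCA prod_cos mulrDr -!natr1.
  by congr (_ * cos _ + _ * cos _); ring.
rewrite exprS IHm mulr_sumr (eq_bigr _ (fun j _ => step (nat_of_ord j))).
rewrite big_split /= [RHS]big_ord_recl.
under [X in _ = _ + X]eq_bigr => j _.
  rewrite /= /bump leq0n add1n binS natrD mulrDl.
  over.
rewrite big_split /= addrA; congr (_ + _).
rewrite [X in _ = _ + X]big_ord_recr /= (bin_small (ltnSn m)) mul0r addr0 big_ord_recl /= !bin0.
by congr (_ + _); apply: eq_bigr => j _; rewrite /bump leq0n add1n.
Qed.

(** * Central binomial coefficients *)

(** Consecutive entries of a row have ratio [(2n - k) / (k + 1)], which is at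
    least 1 on the left half; the right half follows by symmetry. *)
Lemma bin_le_central n j : ('C(n.*2, j) <= 'C(n.*2, n))%N.
Proof.
have below k : (k <= n)%N -> ('C(n.*2, n - k) <= 'C(n.*2, n))%N.
  elim: k => [|k IHk] kn; first by rewrite subn0.
  apply: leq_trans (IHk (ltnW kn)).
  have -> : (n - k = (n - k.+1).+1)%N by lia.
  have := mul_bin_left n.*2 (n - k.+1).
  set a := 'C(_, _.+1); set b := 'C(_, _) => ab.
  have : ((n - k.+1).+1 * b <= (n - k.+1).+1 * a)%N.
    by rewrite ab leq_mul2r; apply/orP; right; lia.
  by rewrite leq_mul2l.
case: (leqP j n) => [jn|nj]; first by rewrite -(subKn jn) below// leq_subr.
case: (leqP j n.*2) => [jn|nj']; last by rewrite bin_small.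
rewrite -bin_sub//.
have -> : (n.*2 - j = n - (j - n))%N by lia.
by apply: below; lia.
Qed.

Lemma central_binS n :
  (n.+1 * 'C(n.+1.*2, n.+1) = 2 * (n.*2.+1 * 'C(n.*2, n)))%N.
Proof.
have h1 := mul_bin_diag n.*2.+2 n.
have h2 := mul_bin_down n.*2.+1 n.
rewrite /= in h1 h2.
have e : (n.*2.+1 - n = n.+1)%N by lia.
rewrite e in h2; rewrite doubleS.
nia.
Qed.

(** The mean of [cos t ^ 2n] over a period, of order [1 / sqrt n]. *)
Definition central_coef {R : realType} n : R := 'C(n.*2, n)%:R / 4 ^+ n.

Lemma central_coefS (R : realType) n :
  n.+1%:R * central_coef n.+1 = (n%:R + 2^-1) * central_coef n :> R.
Proof.
rewrite /central_coef exprS.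
have := congr1 (fun k => k%:R : R) (central_binS n).
have d : n.*2%:R = 2 * n%:R :> R by rewrite -mul2n natrM.
rewrite !natrM -[n.*2.+1%:R]natr1 d => h.
rewrite [LHS]mulrA h; field.
by rewrite expf_neq0.
Qed.

Lemma central_coef_gt0 (R : realType) n : 0 < central_coef n :> R.
Proof.
by rewrite divr_gt0 ?exprn_gt0// ltr0n bin_gt0 -addnn leq_addr.
Qed.

(** The factors [2n + 1] here and [4n] in [central_coef_ge] are the Wallis
    normalisations: they make the two products monotone in n, by the recurrence
    [central_coefS]. *)
Lemma central_coef_le (R : realType) n :
  (2 * n%:R + 1) * central_coef n ^+ 2 <= 1 :> R.
Proof.
elim: n => [|n IHn].
  by rewrite /central_coef bin0; lra.
have n0 : 0 <= n%:R :> R by [].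
have h := central_coefS R n.
set a := central_coef n in IHn h *; set b := central_coef n.+1 in h *.
rewrite -natr1 in h *.
have hb : b = (n%:R + 2^-1) * a / (n%:R + 1).
  by rewrite -h mulrAC divff ?mul1r// lt0r_neq0// ltr_wpDl.
apply: le_trans IHn.
have -> : (2 * (n%:R + 1) + 1) * b ^+ 2 = (2 * n%:R + 1) * a ^+ 2 *
    (1 - (4 * (n%:R + 1) ^+ 2)^-1).
  by rewrite hb; field; rewrite lt0r_neq0// ltr_wpDl.
rewrite ler_piMr//; first by rewrite mulr_ge0 ?sqr_ge0//; lra.
Qed.

Lemma central_coef_ge (R : realType) n :
  (0 < n)%N -> 1 <= 4 * n%:R * central_coef n ^+ 2 :> R.
Proof.
elim: n => [//|[_ _|n /(_ isT) IHn _]].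
  by rewrite /central_coef (_ : 'C(1.*2, 1) = 2%N)//; lra.
have h := central_coefS R n.+1.
set a := central_coef n.+1 in IHn h *; set b := central_coef n.+2 in h *.
have m0 : 0 < n.+1%:R :> R by [].
rewrite -[n.+2%:R]natr1 in h *.
set m : R := n.+1%:R in IHn h m0 *.
have hb : b = (m + 2^-1) * a / (m + 1).
  by rewrite -h mulrAC divff ?mul1r// lt0r_neq0// ltr_wpDl// ltW.
apply: (le_trans IHn).
have -> : 4 * (m + 1) * b ^+ 2 = 4 * m * a ^+ 2 * (1 + (4 * m * (m + 1))^-1).
  by rewrite hb; field; rewrite !lt0r_neq0// ltr_wpDl// ltW.
rewrite ler_peMr//; first by rewrite mulr_ge0 ?sqr_ge0// mulr_ge0// ltW.
by rewrite lerDl invr_ge0 !mulr_ge0 ?addr_ge0// ltW.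
Qed.

(** Squaring a kernel costs only a constant factor in its mean. *)
Lemma central_coef_double (R : realType) n :
  (0 < n)%N -> central_coef n <= 2 * central_coef n.*2 :> R.
Proof.
move=> n0.
have u := central_coef_le R n.
have l : 1 <= 4 * n.*2%:R * central_coef n.*2 ^+ 2 :> R.
  by apply: central_coef_ge; rewrite double_gt0.
have [a0 b0] := (central_coef_gt0 R n, central_coef_gt0 R n.*2).
have m0 : 0 < n%:R :> R by rewrite ltr0n.
rewrite -mul2n natrM mul2n in l.
set a := central_coef n in u a0 *; set b := central_coef _ in l b0 *.
suff ab : a ^+ 2 <= (2 * b) ^+ 2 by move: ab; rewrite ler_pXn2r// nnegrE; lra.
rewrite [leRHS]exprMn -(ler_pM2l m0).
by move: u l (sqr_ge0 a); rewrite mulrDl mul1r; nra.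
Qed.

(** * Kernels tested against the measure *)

Lemma measurable_unit_circle (R : realType) :
  measurable (unit_circle : set (measurableTypeR R)).
Proof. exact: measurable_itv. Qed.

Section prob.
Context {R : realType} (mu : probability (measurableTypeR R) R).
Hypothesis mu_circle : mu unit_circle = 1%E.

Lemma integrable_of_bounded (f : measurableTypeR R -> R) M :
  measurable_fun setT f -> (forall y, `|f y| <= M) ->
  mu.-integrable unit_circle (EFin \o f).
Proof.
move=> mf fM; apply: measurable_bounded_integrable.
- exact: measurable_unit_circle.
- by apply: le_lt_trans (probability_le1 mu (measurable_unit_circle R)) _; rewrite ltry.
- exact: measurable_funTS.
- exists M; split; first exact: num_real.
  by move=> N MN y _; apply: le_trans (fM y) (ltW MN).
Qed.

Lemma Rintegral_bigsum (I : Type) (s : seq I) (F : I -> measurableTypeR R -> R) :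
  (forall i, mu.-integrable unit_circle (EFin \o F i)) ->
  \int[mu]_(y in unit_circle) (\sum_(i <- s) F i y) =
  \sum_(i <- s) \int[mu]_(y in unit_circle) F i y.
Proof.
move=> intF; have mU := measurable_unit_circle R.
suff [] : mu.-integrable unit_circle (EFin \o (fun y => \sum_(i <- s) F i y)) /\
  \int[mu]_(y in unit_circle) (\sum_(i <- s) F i y) =
  \sum_(i <- s) \int[mu]_(y in unit_circle) F i y by [].
elim: s => [|i s [IHi IHs]].
  rewrite big_nil; split.
    apply: eq_integrable (integrable0 mu unit_circle) => // y _.
    by rewrite /= big_nil.
  by under eq_Rintegral do rewrite big_nil; rewrite Rintegral_cst// mul0r.
split.
  apply: eq_integrable (integrableD mU (intF i) IHi) => // y _.
  by rewrite /= big_cons EFinD.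
under eq_Rintegral do rewrite big_cons.
by rewrite RintegralD// IHs big_cons.
Qed.

Lemma measurable_cos_affine (a b : R) :
  measurable_fun setT (fun y : measurableTypeR R => cos (a * (y - b))).
Proof.
apply: (measurableT_comp (f := @cos R)).
  by apply: continuous_measurable_fun; exact: continuous_cos.
apply: continuous_measurable_fun => y.
apply: cvgM; first exact: cvg_cst.
by apply: cvgB; [exact: cvg_id|exact: cvg_cst].
Qed.

Lemma integrable_cos_affine (a b : R) :
  mu.-integrable unit_circle (EFin \o (fun y => cos (a * (y - b)))).
Proof.
apply: (@integrable_of_bounded _ 1); first exact: measurable_cos_affine.
by move=> y; exact: cos_max.
Qed.

Lemma integrable_sin (a : R) :
  mu.-integrable unit_circle (EFin \o (fun y => sin (a * y))).
Proof.
apply: (@integrable_of_bounded _ 1); last by move=> y; exact: sin_max.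
apply: (measurableT_comp (f := @sin R)).
  by apply: continuous_measurable_fun; exact: continuous_sin.
apply: continuous_measurable_fun => y.
by apply: cvgM; [exact: cvg_cst|exact: cvg_id].
Qed.

Definition coef_norm (k : nat) : R :=
  ComplexField.Normc.normc (fourier_coef mu k%:Z).

(** The left side is the real part of a unimodular multiple of the coefficient:
    [cos (a (y - x))] splits with weights [cos (a x)] and [sin (a x)], and the
    bound is the Cauchy-Schwarz inequality in the plane. *)
Lemma Rintegral_cos_le k x :
  `|\int[mu]_(y in unit_circle) cos (2 * k%:R * pi * (y - x))| <= coef_norm k.
Proof.
have mU := measurable_unit_circle R.
pose a : R := 2 * k%:R * pi.
have arg (y : R) : 2 * pi * (- k%:~R * y) = - (a * y) by rewrite /a; ring.
have intc : mu.-integrable unit_circle (EFin \o (fun y => cos (a * y))).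
  by have := integrable_cos_affine a 0; under eq_fun do rewrite /= subr0.
have ints := integrable_sin a.
pose C := \int[mu]_(y in unit_circle) cos (a * y).
pose D := \int[mu]_(y in unit_circle) sin (a * y).
have -> : coef_norm k = Num.sqrt (C ^+ 2 + D ^+ 2).
  rewrite /coef_norm /fourier_coef /complex_integral /e /=.
  congr (Num.sqrt (_ ^+ 2 + _)).
    by apply: eq_Rintegral => y _; rewrite arg cosN.
  rewrite -(sqrrN D) -[- D]mulN1r -RintegralZl//; congr (_ ^+ 2).
  by apply: eq_Rintegral => y _; rewrite arg sinN mulN1r.
have -> : \int[mu]_(y in unit_circle) cos (a * (y - x)) =
    cos (a * x) * C + sin (a * x) * D.
  rewrite -!RintegralZl// -RintegralD//.
  - by apply: eq_Rintegral => y _; rewrite mulrBr cosB; ring.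
  - exact: (integrableZl mU (cos (a * x)) intc).
  - exact: (integrableZl mU (sin (a * x)) ints).
rewrite -sqrtr_sqr ler_wsqrtr// -[leRHS]mul1r -(cos2Dsin2 (a * x)).
rewrite -subr_ge0; set c := cos _; set s := sin _.
have -> : (c ^+ 2 + s ^+ 2) * (C ^+ 2 + D ^+ 2) - (c * C + s * D) ^+ 2 =
  (s * C - c * D) ^+ 2 by ring.
exact: sqr_ge0.
Qed.

(** Written as a power of the square so that it is visibly nonnegative. *)
Definition cos_kernel (x : R) n y : R := (cos (pi * (y - x)) ^+ 2) ^+ n.

Lemma measurable_cos_kernel x n :
  measurable_fun setT (cos_kernel x n : measurableTypeR R -> R).
Proof.
by do 2 apply: measurable_funX; exact: measurable_cos_affine.
Qed.

Lemma cos_kernel_ge0 x n y : 0 <= cos_kernel x n y.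
Proof. by rewrite exprn_ge0// sqr_ge0. Qed.

Lemma integrable_cos_kernel x n :
  mu.-integrable unit_circle (EFin \o cos_kernel x n).
Proof.
apply: (@integrable_of_bounded _ 1); first exact: measurable_cos_kernel.
by move=> y; rewrite ger0_norm ?cos_kernel_ge0// exprn_ile1// ?sqr_ge0//.
Qed.

Lemma cos_kernelE x n y : cos_kernel x n y =
  \sum_(0 <= j < n.*2.+1)
    ('C(n.*2, j)%:R / 4 ^+ n) * cos (2 * (n%:R - j%:R) * pi * (y - x)).
Proof.
have h := cos_expn_sum R (pi * (y - x)) n.*2.
have sqr2 : (2 * cos (pi * (y - x))) ^+ 2 = 4 * cos (pi * (y - x)) ^+ 2 by ring.
rewrite -{1}mul2n exprM sqr2 exprMn_comm in h; last exact: mulrC.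
have -> : cos_kernel x n y = 4 ^+ n * (cos (pi * (y - x)) ^+ 2) ^+ n / 4 ^+ n.
  by rewrite mulrAC divff ?mul1r// expf_neq0.
rewrite h mulr_suml big_mkord; apply: eq_bigr => j _.
rewrite mulrAC; congr (_ * cos _).
have -> : n.*2%:R = 2 * n%:R :> R by rewrite -mul2n natrM.
by ring.
Qed.

(** In the expansion [cos_kernelE] the term [j = n] is the constant
    [central_coef n]. Every other weight is at most [central_coef n], since
    binomial coefficients peak in the middle, and its frequency [n - j] is
    nonzero; each of [1, 2, ..., n] occurs twice up to sign, whence [2 * S]. *)
Lemma cos_kernel_integral S x n :
  (forall N, \sum_(1 <= k < N.+1) coef_norm k <= S) ->
  `|\int[mu]_(y in unit_circle) cos_kernel x n y - central_coef n|
    <= 2 * S * central_coef n.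
Proof.
move=> hS; have mU := measurable_unit_circle R.
pose w j : R := 'C(n.*2, j)%:R / 4 ^+ n.
pose I j := \int[mu]_(y in unit_circle) cos (2 * (n%:R - j%:R) * pi * (y - x)).
have w0 j : 0 <= w j by rewrite divr_ge0// exprn_ge0.
have wle j : w j <= central_coef n.
  by rewrite ler_wpM2r ?invr_ge0 ?exprn_ge0// ler_nat bin_le_central.
have -> : \int[mu]_(y in unit_circle) cos_kernel x n y =
    \sum_(0 <= j < n.*2.+1) w j * I j.
  under eq_Rintegral do rewrite cos_kernelE.
  rewrite Rintegral_bigsum; last first.
    move=> j.
    exact: (integrableZl mU (w j) (integrable_cos_affine _ _)).
  apply: eq_bigr => j _; rewrite RintegralZl//; exact: integrable_cos_affine.
have In : I n = 1.
  rewrite /I subrr mulr0 mul0r; under eq_Rintegral do rewrite mul0r cos0.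
  by rewrite Rintegral_cst// mul1r; exact: (congr1 fine mu_circle).
rewrite (@big_cat_nat _ _ _ n)//=; last by lia.
rewrite [X in `|_ + X - _|]big_ltn; last by lia.
rewrite In mulr1 (_ : w n = central_coef n)//.
rewrite [X in `|X|](_ : _ = \sum_(0 <= j < n) w j * I j +
   \sum_(n.+1 <= j < n.*2.+1) w j * I j); last by ring.
apply: le_trans (ler_normD _ _) _.
rewrite -mulrA mulrDl mul1r lerD//.
- apply: le_trans (ler_norm_sum _ _ _) _.
  apply: le_trans (ler_wpM2r (ltW (central_coef_gt0 R n)) (hS n)).
  (* Reversing the range turns the frequency n - j into j + 1. *)
  rewrite big_add1/= big_nat_rev/= mulr_suml big_nat [leRHS]big_nat.
  apply: ler_sum => j /andP[_ jn]; rewrite normrM ger0_norm// mulrC.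
  apply: ler_pM => //; rewrite add0n.
  have := Rintegral_cos_le j.+1 x.
  by rewrite /I -natrB ?leq_subr// subKn.
- apply: le_trans (ler_norm_sum _ _ _) _.
  apply: le_trans (ler_wpM2r (ltW (central_coef_gt0 R n)) (hS n)).
  rewrite -add1n big_addn mulr_suml (_ : (n.*2.+1 - n = n.+1)%N); last by lia.
  apply: ler_sum => j _; rewrite normrM ger0_norm// mulrC.
  apply: ler_pM => //.
  have := Rintegral_cos_le j x; rewrite /I natrD opprD addrCA subrr addr0.
  congr (`|_| <= _); apply: eq_Rintegral => y _.
  by rewrite -cosN; congr cos; ring.
Qed.

End prob.

(** * Elementary inequalities *)

Lemma bernoulli_ge (R : realType) (u : R) n :
  -1 <= u -> 1 + n%:R * u <= (1 + u) ^+ n.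
Proof.
move=> u1; elim: n => [|n IHn]; first by rewrite mul0r addr0 expr0.
have u0 : 0 <= 1 + u by lra.
rewrite exprS; apply: le_trans (ler_wpM2l u0 IHn).
rewrite -natr1 -subr_ge0.
have -> : (1 + u) * (1 + n%:R * u) - (1 + (n%:R + 1) * u) = n%:R * u ^+ 2 by ring.
by rewrite mulr_ge0// sqr_ge0.
Qed.

(** [(1 - u)^n (1 + u)^n <= 1] combined with Bernoulli's inequality. *)
Lemma expn_one_minus_le (R : realType) (u : R) n :
  0 <= u <= 1 -> (1 - u) ^+ n <= (1 + n%:R * u)^-1.
Proof.
move=> /andP[u0 u1].
have nu : 0 < 1 + n%:R * u by rewrite ltr_wpDr// mulr_ge0.
rewrite -[leRHS]mul1r ler_pdivlMr//.
have h : 1 + n%:R * u <= (1 + u) ^+ n by apply: bernoulli_ge; lra.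
apply: le_trans (ler_wpM2l _ h) _; first by rewrite exprn_ge0// subr_ge0.
rewrite -exprMn_comm; last exact: mulrC.
have -> : (1 - u) * (1 + u) = 1 - u ^+ 2 by ring.
by rewrite exprn_ile1 ?subr_ge0 ?exprn_ile1// gerBl sqr_ge0.
Qed.

Lemma sin_bounds (R : realType) (t : R) :
  0 <= t <= 1 -> cos 1 * t <= sin t <= t.
Proof.
move=> /andP[t0 t1].
have [c /[!in_itv]/= /andP[c0 ct]] : exists2 c, c \in `[0, t] &
    sin t - sin 0 = cos c * (t - 0).
  by apply: MVT_segment => //; apply: continuous_subspaceT; exact: continuous_sin.
rewrite sin0 !subr0 => ->; rewrite ler_wpM2r//=; last first.
  have c1 := le_trans ct t1; have p2 := pi_ge2 R.
  rewrite leNgt ltr_cos -?leNgt// in_itv/=; lra.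
by rewrite ler_piMl// cos_le1.
Qed.

Lemma sin_sqr_le (R : realType) (t : R) : 0 <= t -> sin t ^+ 2 <= t ^+ 2.
Proof.
move=> t0; case: (leP t 1) => t1.
  have /andP[s0 s1] : cos 1 * t <= sin t <= t by apply: sin_bounds; rewrite t0.
  by rewrite lerXn2r ?nnegrE//; apply: le_trans s0; rewrite mulr_ge0// ltW// cos1_gt0.
have := cos2Dsin2 t; have := sqr_ge0 (cos t); nra.
Qed.

(** * Mass of small balls *)

Lemma circle_dist_bounds (R : realType) (x y : R) :
  0 < x < 1 -> unit_circle y -> 0 <= circle_dist x y <= 2^-1.
Proof.
rewrite /unit_circle /circle_dist /= in_itv/= => /andP[x0 x1] /andP[y0 y1].
have : `|x - y| <= 1 by rewrite ler_norml; lra.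
have := normr_ge0 (x - y).
by rewrite ge_min le_min; lra.
Qed.

(** The square of the sine has period pi, so it does not see whether the
    distance is measured along the interval or across the glued endpoint. *)
Lemma sin_circle_dist (R : realType) (x y : R) :
  sin (pi * (y - x)) ^+ 2 = sin (pi * circle_dist x y) ^+ 2.
Proof.
have -> : sin (pi * (y - x)) ^+ 2 = sin (pi * `|x - y|) ^+ 2.
  case: ger0P => _; last by congr (sin _ ^+ 2); ring.
  by rewrite -sqrrN -sinN; congr (sin _ ^+ 2); ring.
rewrite /circle_dist minEle; case: ifP => // _.
by rewrite mulrBr mulr1 [pi - _]addrC sinDpi sinN opprK.
Qed.

(** The sine increases on [0, pi/2], so moving away from the centre only
    increases [sin (pi d) ^ 2]. *)
Lemma sin_sqr_ge_off_ball (R : realType) (x y r : R) :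
  0 < x < 1 -> unit_circle y -> 0 <= r -> r <= circle_dist x y ->
  sin (pi * r) ^+ 2 <= sin (pi * (y - x)) ^+ 2.
Proof.
move=> x01 Uy r0 rd.
have /andP[d0 d1] := circle_dist_bounds R x y x01 Uy.
have mem (t : R) : 0 <= t -> t <= 2^-1 -> pi * t \in `[- (pi / 2), pi / 2].
  move=> t0 t1; rewrite in_itv/= ler_wpM2l ?pi_ge0// andbT.
  by apply: (@le_trans _ _ 0);
    [rewrite oppr_le0 divr_ge0 ?pi_ge0|rewrite mulr_ge0// pi_ge0].
have r2 := le_trans rd d1.
have sr0 : 0 <= sin (pi * r).
  by apply: sin_ge0_pi; rewrite mulr_ge0 ?pi_ge0//= ler_piMr ?pi_ge0//; lra.
rewrite sin_circle_dist; suff le_sin : sin (pi * r) <= sin (pi * circle_dist x y).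
  by rewrite lerXn2r ?nnegrE// (le_trans sr0).
move: rd; rewrite le_eqVlt => /predU1P[<-//|rd].
by rewrite ltW// ltr_sin ?mem ?ltr_pM2l ?pi_gt0// ltW.
Qed.

Lemma measurable_circle_ball (R : realType) (x r : R) :
  measurable (circle_ball x r : set (measurableTypeR R)).
Proof.
apply: measurableI; first exact: measurable_unit_circle.
have cd : continuous (fun y : R => `|x - y|).
  move=> y; apply: (@continuous_comp _ _ _ (fun y => x - y) Num.norm).
    by apply: cvgB; [exact: cvg_cst|exact: cvg_id].
  exact: norm_continuous.
have -> : [set y | circle_dist x y < r] =
  [set y : R | `|x - y| < r] `|` [set y : R | 1 - `|x - y| < r].
  apply/seteqP; split=> y; rewrite /= /circle_dist gt_min.
    by move=> /orP.
  by move=> ?; apply/orP.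
have lt_open (f : R -> R) : continuous f -> open [set y | f y < r].
  move=> cf; apply: (@open_comp R R f [set z | z < r]) => [y _|].
    exact: cf.
  exact: open_lt.
apply: measurableU; apply: open_measurable; apply: lt_open => // y.
by apply: cvgB; [exact: cvg_cst|exact: cd].
Qed.

Section bounds.
Context {R : realType} (mu : probability (measurableTypeR R) R).
Hypothesis mu_circle : mu unit_circle = 1%E.
Variables (S : R).
Hypothesis coefS : forall N, \sum_(1 <= k < N.+1) coef_norm mu k <= S.
Hypothesis S_lt : S < 2^-1.
Variables (x : R).
Hypothesis x01 : 0 < x < 1.

Let mU := measurable_unit_circle R.

Lemma Rintegral_ball r :
  \int[mu]_(y in unit_circle) \1_(circle_ball x r) y = fine (mu (circle_ball x r)).
Proof.
rewrite /Rintegral integral_indic//; last exact: measurable_circle_ball.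
by congr (fine (mu _)); apply: setIidl => y [].
Qed.

Lemma integrable_ball r :
  mu.-integrable unit_circle (EFin \o \1_(circle_ball x r)).
Proof.
apply: (@integrable_of_bounded _ _ _ 1).
  by apply: measurable_indic; exact: measurable_circle_ball.
by move=> y; rewrite indicE; case: (_ \in _); rewrite ?normr0 ?normr1.
Qed.

Lemma cos_kernel_integral_bounds n :
  (1 - 2 * S) * central_coef n
    <= \int[mu]_(y in unit_circle) cos_kernel x n y <= 2 * central_coef n.
Proof.
have := cos_kernel_integral mu mu_circle S x n coefS.
rewrite ler_norml => /andP[h1 h2].
have a0 := central_coef_gt0 R n.
have a_S : S * central_coef n <= 2^-1 * central_coef n.
  by rewrite ler_wpM2r// ltW.
rewrite mulrBl mul1r -mulrA; rewrite -mulrA in h1 h2.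
by apply/andP; split; lra.
Qed.

(** With [n] of order [1 / r^2] the kernel is at least 1/2 on the ball, while
    its integral is of order [1 / sqrt n], that is, of order [r]. *)
Lemma ball_mass_le (r : R) : 0 < r -> pi * r <= 1 ->
  fine (mu (circle_ball x r)) <= 8 * pi * r.
Proof.
move=> r0 r1; have p0 := pi_gt0 R.
pose u := (pi * r) ^+ 2.
have u0 : 0 < u by rewrite exprn_gt0// mulr_gt0.
have u1 : u <= 1 by rewrite exprn_ile1// mulr_ge0// ltW.
(* The largest n for which Bernoulli gives 1 - n u >= 1/2. *)
pose n := Num.truncn (2 * u)^-1.
have /andP[n_le n_gt] : n%:R <= (2 * u)^-1 < n.+1%:R.
  by apply: truncn_itv; rewrite invr_ge0; lra.
have ker_ge y : unit_circle y ->
    2^-1 * \1_(circle_ball x r) y <= cos_kernel x n y.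
  move=> Uy; rewrite indicE; case: (boolP (y \in _)); last first.
    by rewrite mulr0 cos_kernel_ge0.
  rewrite inE mulr1 => -[_ /= yr].
  have /andP[d0 _] := circle_dist_bounds R x y x01 Uy.
  have cos_ge : 1 - u <= cos (pi * (y - x)) ^+ 2.
    rewrite cos2sin2 lerB// sin_circle_dist.
    apply: le_trans (sin_sqr_le _ _ _) _; first by rewrite mulr_ge0// ltW.
    by rewrite lerXn2r ?nnegrE ?mulr_ge0 ?ler_pM2l// ltW.
  apply: (@le_trans _ _ ((1 - u) ^+ n)); last first.
    by rewrite lerXn2r ?nnegrE ?sqr_ge0// subr_ge0.
  apply: le_trans (bernoulli_ge _ (- u) n _); last by lra.
  have : n%:R * u <= (2 * u)^-1 * u by rewrite ler_pM2r.
  by rewrite invfM mulrAC -mulrA mulfV ?lt0r_neq0//; lra.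
have half : 2^-1 * fine (mu (circle_ball x r)) <= 2 * central_coef n.
  rewrite -Rintegral_ball -RintegralZl//; last exact: integrable_ball.
  have /andP[_] := cos_kernel_integral_bounds n; apply: le_trans.
  apply: le_Rintegral => //; last exact: integrable_cos_kernel.
  exact: (integrableZl mU 2^-1 (integrable_ball r)).
have a0 := central_coef_gt0 R n.
suff : central_coef n <= 2 * (pi * r) by lra.
have pr : 0 <= pi * r by rewrite mulr_ge0// ltW.
suff ab : central_coef n ^+ 2 <= (2 * (pi * r)) ^+ 2.
  by move: ab; rewrite ler_pXn2r// nnegrE; lra.
have -> : (2 * (pi * r)) ^+ 2 = 4 * u by rewrite /u; ring.
have le1 := central_coef_le R n.
set q := central_coef n ^+ 2 in le1 *.
have q0 : 0 <= q by exact: sqr_ge0.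
have : 1 <= 2 * u * n.+1%:R.
  by rewrite mulrC -ler_pdivrMr ?mulr_gt0// mul1r ltW.
have : (2 * n%:R + 1) * q * u <= u by rewrite ler_piMl// ltW.
rewrite -natr1; move: (ler0n R n); set m := n%:R => m0 le_u h.
have uq : 0 <= u * q by rewrite mulr_ge0// ltW.
have := ler_wpM2l q0 h.
nra.
Qed.

(** The kernel of order [2n] has integral at least a multiple of
    [central_coef n]. Outside the ball it is at most [(1 - s)^n] times the
    kernel of order [n], where [s = sin (pi r) ^ 2]; once [n r^2] is a large
    constant this tail cannot account for the whole integral, and the rest is
    at most the mass of the ball. *)
Lemma ball_mass_ge (r : R) : 0 < r -> pi * r <= 1 ->
  ((1 - 2 * S) ^+ 2 * cos 1 / 24) * r <= fine (mu (circle_ball x r)).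
Proof.
move=> r0 r1; have p2 := pi_ge2 R; have k0 := cos1_gt0 R.
have k1 := cos_le1 (1 : R).
have S0 : 0 <= S by have := coefS 0; rewrite big_geq.
have r2 : r <= 2^-1 by have := ler_wpM2r (ltW r0) p2; lra.
set eta := 1 - 2 * S; set kappa := cos 1.
have eta01 : 0 < eta <= 1 by move: S_lt; rewrite /eta; lra.
pose v := eta * (kappa * r) ^+ 2.
pose s := sin (pi * r) ^+ 2.
have kr : 0 < kappa * r by rewrite mulr_gt0.
have v0 : 0 < v by case/andP: eta01 => ? _; rewrite mulr_gt0// exprn_gt0.
have v1 : v <= 1.
  have : kappa * r <= 1 by rewrite mulr_ile1 ?(ltW k0) ?(ltW r0)//; lra.
  case/andP: eta01 => e0 e1 kr1.
  by rewrite mulr_ile1 ?exprn_ile1 ?sqr_ge0// ltW.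
have s_ge : (kappa * r) ^+ 2 <= s.
  have /andP[sl _] : cos 1 * (pi * r) <= sin (pi * r) <= pi * r.
    by apply: sin_bounds; rewrite r1 mulr_ge0; lra.
  have k_le : kappa * r <= sin (pi * r).
    by apply: le_trans sl; rewrite ler_pM2l// ler_peMl// ?ltW//; lra.
  by rewrite /s lerXn2r ?nnegrE ?(le_trans _ k_le)// ltW.
have s01 : 0 <= s <= 1.
  by rewrite sqr_ge0/= -(cos2Dsin2 (pi * r)) lerDr sqr_ge0.
(* Since eta n s >= n v >= 8, the factor (1 - s)^n is at most eta / 8, so the
   tail uses up at most half of the lower bound eta * central_coef n / 2. *)
pose n := (Num.truncn (8 / v)).+1.
have v8 : 0 <= 8 / v by rewrite divr_ge0// ltW.
have /andP[n_le n_gt] := truncn_itv v8.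
have n_ge8 : 8 <= n%:R * v by rewrite -ler_pdivrMr// ltW.
have n_le9 : n%:R * v <= 9.
  rewrite /n -natr1 mulrDl mul1r (_ : 9 = 8 + 1); last by ring.
  by rewrite lerD// -ler_pdivlMr.
have tail y : unit_circle y -> cos_kernel x n.*2 y <=
    \1_(circle_ball x r) y + (1 - s) ^+ n * cos_kernel x n y.
  move=> Uy; rewrite indicE; case: (boolP (y \in _)) => yB.
    rewrite -[leLHS]addr0 lerD//.
      by rewrite exprn_ile1 ?sqr_ge0// cos2sin2 gerBl sqr_ge0.
    by rewrite mulr_ge0 ?cos_kernel_ge0// exprn_ge0// subr_ge0; case/andP: s01.
  rewrite add0r /cos_kernel -addnn exprD ler_wpM2r ?(cos_kernel_ge0 x n y)//.
  have rd : r <= circle_dist x y.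
    by rewrite leNgt; apply: contra yB => ?; rewrite inE; split.
  rewrite lerXn2r ?nnegrE ?sqr_ge0 ?subr_ge0//; first by case/andP: s01.
  by rewrite cos2sin2 lerB// /s (sin_sqr_ge_off_ball _ _ _ _ x01 Uy (ltW r0)).
have a0 := central_coef_gt0 R n.
have /andP[lo _] := cos_kernel_integral_bounds n.*2.
have /andP[_ up] := cos_kernel_integral_bounds n.
have dbl : central_coef n <= 2 * central_coef n.*2 :> R by exact: central_coef_double.
have main : eta * central_coef n.*2 <=
    fine (mu (circle_ball x r)) + (1 - s) ^+ n * (2 * central_coef n).
  apply: (le_trans lo).
  have intk := integrable_cos_kernel mu x n.
  apply: (@le_trans _ _ (\int[mu]_(y in unit_circle)
      (\1_(circle_ball x r) y + (1 - s) ^+ n * cos_kernel x n y))).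
    apply: le_Rintegral => //; first exact: integrable_cos_kernel.
    exact: (integrableD mU (integrable_ball r) (integrableZl mU _ intk)).
  rewrite RintegralD//; first last.
  - exact: (integrableZl mU _ intk).
  - exact: integrable_ball.
  rewrite Rintegral_ball lerD// RintegralZl// ler_wpM2l//.
  by rewrite exprn_ge0// subr_ge0; case/andP: s01.
have decay : (1 - s) ^+ n <= eta / 8.
  apply: le_trans (expn_one_minus_le _ _ n s01) _.
  case/andP: eta01 => e0 e1.
  rewrite -[leLHS]mul1r ler_pdivrMr; last first.
    by rewrite ltr_wpDr// mulr_ge0//; case/andP: s01.
  have : n%:R * v <= eta * (n%:R * s).
    by rewrite /v mulrCA ler_wpM2l ?(ltW e0)// ler_wpM2l.
  lra.
have mass : eta / 4 * central_coef n <= fine (mu (circle_ball x r)).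
  have := ler_wpM2r (ltW a0) decay; case/andP: eta01 => e0 e1.
  have := ler_wpM2l (ltW e0) dbl.
  lra.
apply: le_trans mass; case/andP: eta01 => e0 e1.
have -> : eta ^+ 2 * kappa / 24 * r = eta / 4 * (eta * (kappa * r) / 6) by field.
rewrite ler_pM2l; last by lra.
suff ab : (eta * (kappa * r) / 6) ^+ 2 <= central_coef n ^+ 2.
  move: ab; rewrite ler_pXn2r// nnegrE; last exact: ltW.
  by rewrite divr_ge0// mulr_ge0 ?(ltW e0) ?(ltW kr).
have an := central_coef_ge R n isT.
set q := central_coef n ^+ 2 in an *.
have q0 : 0 <= q by exact: sqr_ge0.
have : v <= 36 * q.
  have := ler_wpM2l (ltW v0) an; have := ler_wpM2r q0 n_le9; lra.
have : (eta * (kappa * r) / 6) ^+ 2 * 36 = eta * v by rewrite /v; field.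
have : eta * v <= v by rewrite ler_piMl// ltW.
lra.
Qed.

End bounds.

(** * From linear mass bounds to the local dimension *)

Lemma limf_esup_near (T : choiceType) (X : filteredType T) (R : realType) (f : X -> \bar R)
    (F : set_system X) (l : R) : ProperFilter F ->
  (forall eps : R, 0 < eps ->
    \forall t \near F, ((l - eps)%:E <= f t <= (l + eps)%:E)%E) ->
  limf_esup f F = l%:E.
Proof.
move=> FF near_l; rewrite limf_esupE; apply/eqP; rewrite eq_le; apply/andP; split.
- apply/lee_addgt0Pr => eps /near_l near_eps.
  apply: (@le_trans _ _ (ereal_sup (f @`
    [set t | ((l - eps)%:E <= f t <= (l + eps)%:E)%E]))).
    by apply: ereal_inf_lbound; exists [set t | ((l - eps)%:E <= f t <= (l + eps)%:E)%E].
  by apply: ge_ereal_sup => _ [t /andP[_ ft] <-]; rewrite -EFinD.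
- apply: le_ereal_inf_tmp => _ [V FV <-]; apply/lee_subgt0Pr => eps /near_l near_eps.
  have [t [Vt /andP[tl _]]] := filter_ex (filterI FV near_eps).
  by rewrite -EFinB; apply: le_trans tl _; apply: ereal_sup_ubound; exists t.
Qed.

Lemma limf_einf_near (T : choiceType) (X : filteredType T) (R : realType) (f : X -> \bar R)
    (F : set_system X) (l : R) : ProperFilter F ->
  (forall eps : R, 0 < eps ->
    \forall t \near F, ((l - eps)%:E <= f t <= (l + eps)%:E)%E) ->
  limf_einf f F = l%:E.
Proof.
move=> FF near_l; rewrite /limf_einf (@limf_esup_near _ _ _ _ _ (- l)) ?EFinN ?oppeK//.
move=> eps /near_l; apply: filterS => t /andP[h1 h2].
by rewrite leeNr leeNl -!EFinN opprB opprK addrC h2 opprD opprK h1.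
Qed.

(** Constants disappear on the logarithmic scale: [log (C r) / log r] differs
    from 1 by [log C / log r], which tends to 0. *)
Lemma log_ratio_near (R : realType) (mu : probability (measurableTypeR R) R)
    (x c C delta : R) : 0 < c -> 0 < C -> 0 < delta ->
  (forall r, 0 < r -> r <= delta ->
     c * r <= fine (mu (circle_ball x r)) <= C * r) ->
  forall eps : R, 0 < eps ->
  \forall r \near 0^'+,
    ((1 - eps)%:E <= log_ratio mu x r <= (1 + eps)%:E)%E.
Proof.
move=> c0 C0 delta0 bnd eps eps0.
(* The summand 1 makes K positive. *)
pose K := Num.max `|ln c| `|ln C| + 1.
have K0 : 0 < K by rewrite ltr_wpDl// le_max normr_ge0.
near=> r.
have r0 : 0 < r by near: r; exact: nbhs_right_gt.
have /bnd : r <= delta by near: r; exact: nbhs_right_le.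
have rK : r <= expR (- (K / eps)) by near: r; apply: nbhs_right_le; exact: expR_gt0.
move=> /(_ r0); set m := fine _ => /andP[cm mC].
have m0 : 0 < m by apply: lt_le_trans cm; rewrite mulr_gt0.
have lnr : ln r <= - (K / eps).
  by rewrite -[leRHS]expRK ler_ln// posrE// expR_gt0.
have KE : 0 < K / eps by rewrite divr_gt0.
have lnr0 : ln r < 0 by lra.
have -> : log_ratio mu x r = (ln m / ln r)%:E.
  have mE : mu (circle_ball x r) = m%:E.
    by rewrite fineK// fin_num_measure//; exact: measurable_circle_ball.
  rewrite /log_ratio [X in lne X](_ : _ = m%:E); last exact: mE.
  by rewrite lne_EFin// inver lt_eqF// -EFinM.
have lo : ln c + ln r <= ln m by rewrite -lnM ?posrE// ler_ln// posrE mulr_gt0.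
have up : ln m <= ln C + ln r by rewrite -lnM ?posrE// ler_ln// posrE mulr_gt0.
have Keps : K <= eps * - ln r by rewrite mulrC -ler_pdivrMr//; lra.
have lnc : `|ln c| <= K by rewrite /K; apply: ler_wpDr => //; rewrite le_max lexx.
have lnC : `|ln C| <= K by rewrite /K; apply: ler_wpDr => //; rewrite le_max lexx orbT.
move: lnc lnC; rewrite !ler_norml => /andP[c1 c2] /andP[C1 C2].
by rewrite !lee_fin ler_ndivlMr// ler_ndivrMr//; apply/andP; split; lra.
Unshelve. all: by end_near.
Qed.

Theorem theorem4p2 (R : realType) (mu : probability (measurableTypeR R) R)
    (mu_circle : mu unit_circle = 1%E)
    (mu_fourier : (\sum_(1 <= n <oo)
       (ComplexField.Normc.normc (fourier_coef mu n%:Z))%:E < (2^-1)%:E)%E)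
    (x : R) (x_gt0 : 0 < x) (x_lt1 : x < 1) :
  local_dim_exists mu x /\ local_dim mu x = 1%E.
Proof.
have x01 : 0 < x < 1 by rewrite x_gt0.
have coef_ge0 k : (0 <= (coef_norm mu k)%:E)%E.
  rewrite lee_fin /coef_norm; case: (fourier_coef _ _) => a b.
  exact: sqrtr_ge0.
set total := (X in (X < _)%E) in mu_fourier.
have total0 : (0 <= total)%E by apply: nneseries_ge0 => k _ _; exact: coef_ge0.
have total_fin : total \is a fin_num.
  by rewrite ge0_fin_numE//; apply: lt_trans mu_fourier _; rewrite ltry.
have S_lt : fine total < 2^-1 by rewrite -lte_fin fineK.
have coefS N : \sum_(1 <= k < N.+1) coef_norm mu k <= fine total.
  rewrite -lee_fin fineK// -sumEFin.
  by apply: nneseries_lim_ge => k _ _; exact: coef_ge0.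
have near1 eps : 0 < eps -> \forall r \near 0^'+,
    ((1 - eps)%:E <= log_ratio mu x r <= (1 + eps)%:E)%E.
  apply: (log_ratio_near R mu x
    ((1 - 2 * fine total) ^+ 2 * cos 1 / 24) (8 * pi) pi^-1).
  - by rewrite divr_gt0// mulr_gt0 ?cos1_gt0// exprn_gt0//; lra.
  - by rewrite mulr_gt0// pi_gt0.
  - by rewrite invr_gt0 pi_gt0.
  move=> r r0 rpi; have pir : pi * r <= 1.
    by rewrite mulrC -ler_pdivlMr ?pi_gt0// mul1r.
  by rewrite (ball_mass_ge mu mu_circle _ coefS)// (ball_mass_le mu mu_circle _ coefS).
have einf1 : lower_local_dim mu x = 1%E.
  by apply: limf_einf_near => //; exact: at_right_proper_filter.
have esup1 : upper_local_dim mu x = 1%E.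
  by apply: limf_esup_near => //; exact: at_right_proper_filter.
by rewrite /local_dim_exists /local_dim einf1 esup1.
Qed.
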